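(* Let $G$ be a simple graph of $n$ vertices with no null vertex and let $F=\{f_i\}_{i\in[n]}$ be a $G(n,k)$-frame for $\mathbb{C}^k$. If $F$ is a tight frame, then $F$ must be a uniform frame.
   Context: $[n]=\{1,\dots,n\}$. A sequence $\{f_i\}_{i\in[n]}$ in $\mathbb{C}^k$ is a frame for $\mathbb{C}^k$ if there are constants $A,B>0$ with $A\|f\|^2\le\sum_{i\in[n]}|\langle f,f_i\rangle|^2\le B\|f\|^2$ for all $f\in\mathbb{C}^k$; it is a tight frame if one can take $A=B$, and a uniform frame if there is a constant $c$ with $\|f_i\|=c$ for all $i\in[n]$. Its Gramian matrix is the $n\times n$ matrix whose $(i,j)$ entry is $\langle f_j,f_i\rangle$ (inner product linear in the first argument). The Laplacian matrix of a simple graph $G$ with vertices $v_1,\dots,v_n$ is $L(G)=D(G)-A(G)$, where $D(G)$ is the diagonal matrix of vertex degrees and $A(G)$ is the adjacency matrix. A frame $\{f_i\}_{i\in[n]}$ for $\mathbb{C}^k$ is a $G(n,k)$-frame if its Gramian matrix equals $L(G)$. A null vertex is a vertex of degree $0$. *)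

(* Defs.v *)
From HB Require Import structures.
From mathcomp Require Import all_boot all_order all_algebra.
From mathcomp Require Import reals complex.

Set Implicit Arguments.
Unset Strict Implicit.
Unset Printing Implicit Defensive.

Import Order.TTheory GRing.Theory Num.Theory.
Local Open Scope ring_scope.
Local Open Scope complex_scope.

Record simple_graph (n : nat) := SimpleGraph {
  adj : rel 'I_n;
  adj_sym : symmetric adj;
  adj_irrefl : irreflexive adj
}.

Section Graph.
Variables (n : nat) (G : simple_graph n).

Definition degree (v : 'I_n) : nat := #|[set w | adj G v w]|.

Definition null_vertex (v : 'I_n) : Prop := degree v = 0%N.

Variable K : pzRingType.

Definition degree_mx : 'M[K]_n := diag_mx (\row_v (degree v)%:R).
Definition adjacency_mx : 'M[K]_n := \matrix_(v, w) (adj G v w)%:R.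
Definition laplacian : 'M[K]_n := degree_mx - adjacency_mx.

End Graph.

Section Frame.
Variables (R : realType) (n k : nat).

Definition vnorm (u : 'rV[R[i]]_k) : R[i] := sqrtC (dotmx u u).

(* [dotmx] is linear in its first argument and conjugate-linear in its second.
   The norms and moduli below are R[i]-valued; [<=] on R[i] compares real parts
   of numbers with equal imaginary parts, so both sides being real, it is the
   usual order of R. *)
Definition frame_bounds (A B : R) (F : 'I_n -> 'rV[R[i]]_k) : Prop :=
  [/\ 0 < A, 0 < B & forall f : 'rV[R[i]]_k,
    A%:C * vnorm f ^+ 2 <= \sum_(i < n) `|dotmx f (F i)| ^+ 2
                        <= B%:C * vnorm f ^+ 2].

Definition is_frame (F : 'I_n -> 'rV[R[i]]_k) : Prop :=
  exists A B : R, frame_bounds A B F.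

Definition tight_frame (F : 'I_n -> 'rV[R[i]]_k) : Prop :=
  exists A : R, frame_bounds A A F.

Definition uniform_frame (F : 'I_n -> 'rV[R[i]]_k) : Prop :=
  is_frame F /\ exists c : R, forall i, vnorm (F i) = c%:C.

Definition gramian (F : 'I_n -> 'rV[R[i]]_k) : 'M[R[i]]_n :=
  \matrix_(i, j) dotmx (F j) (F i).

Definition graph_frame (G : simple_graph n) (F : 'I_n -> 'rV[R[i]]_k) : Prop :=
  is_frame F /\ gramian F = laplacian G R[i].

End Frame.

(* Main.v *)
Require Import Defs.
From mathcomp Require Import all_boot all_order all_algebra.
From mathcomp Require Import reals complex.

Set Implicit Arguments.
Unset Strict Implicit.
Unset Printing Implicit Defensive.

Import Order.TTheory GRing.Theory Num.Theory.
Local Open Scope ring_scope.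
Local Open Scope complex_scope.

(** Test the tightness identity [\sum_i |<f, F i>|^2 = A |f|^2] on a frame
    vector [f = F v]. The inner products involved are the entries of column [v]
    of the Laplacian: [deg v] on the diagonal and, off the diagonal, [-1] for
    each of the [deg v] neighbours of [v] and [0] elsewhere. So the identity
    reads [deg v ^ 2 + deg v = A * deg v] (the left-hand side is computed in
    [sum_sqr_laplacian_col]), and as [deg v] is nonzero, [deg v = A - 1]
    ([tight_graph_frame_degree]): the graph is regular, and all the frame vectors have norm
    [sqrt (A - 1)]. *)

Lemma laplacian_diag (K : pzRingType) n (G : simple_graph n) v :
  laplacian G K v v = (degree G v)%:R.
Proof. by rewrite !mxE eqxx adj_irrefl subr0. Qed.

Lemma laplacian_offdiag (K : pzRingType) n (G : simple_graph n) v w :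
  v != w -> laplacian G K v w = - (adj G v w)%:R.
Proof. by move=> /negPf vw; rewrite !mxE vw mulr0n sub0r. Qed.

Lemma sum_sqr_laplacian_col (K : numDomainType) n (G : simple_graph n) v :
  \sum_(i < n) `|laplacian G K i v| ^+ 2 =
  (degree G v)%:R ^+ 2 + (degree G v)%:R.
Proof.
rewrite (bigD1 v) //= laplacian_diag normr_nat; congr (_ + _).
rewrite (eq_bigr (fun i => (adj G v i)%:R)); last first.
  move=> i iv; rewrite laplacian_offdiag // normrN normr_nat adj_sym.
  by case: (adj G v i); rewrite ?expr1n ?expr0n.
(* The missing index [v] may be restored, since [v] is not its own neighbour. *)
rewrite /degree -sum1dep_card natr_sum big_mkcond [RHS]big_mkcond /=.
apply: eq_bigr => i _; case: eqVneq => [->|_] /=.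
  by rewrite adj_irrefl.
by case: (adj G v i).
Qed.

Section GraphFrame.
Variables (R : realType) (n k : nat) (G : simple_graph n).
Variable F : 'I_n -> 'rV[R[i]]_k.
Hypothesis gramF : gramian F = laplacian G R[i].

Lemma graph_frame_dot i j : dotmx (F j) (F i) = laplacian G R[i] i j.
Proof. by rewrite -gramF mxE. Qed.

Lemma graph_frame_vnorm v : vnorm (F v) = sqrtC (degree G v)%:R.
Proof. by rewrite /vnorm graph_frame_dot laplacian_diag. Qed.

(** The value [A - 1] does not depend on [v]. It comes from testing the frame
    bounds on [F v] itself and cancelling one factor [deg v], which is where
    [v] has to have a neighbour. *)
Lemma tight_graph_frame_degree (A : R) v :
  frame_bounds A A F -> degree G v <> 0%N -> (degree G v)%:R = A - 1.
Proof.
move=> [_ _ tightF] /eqP dv_neq0; have /le_anti := tightF (F v).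
rewrite graph_frame_vnorm sqrtCK.
under eq_bigr do rewrite graph_frame_dot.
rewrite sum_sqr_laplacian_col expr2 -[X in _ + X]mul1r -mulrDl.
move/mulIf; rewrite pnatr_eq0 => /(_ dv_neq0) A_eq.
apply/(addIr 1); rewrite subrK; apply/(@complexI R).
by rewrite A_eq rmorphD rmorph1 rmorph_nat.
Qed.

End GraphFrame.

Theorem corollary4p4 (R : realType) (n k : nat) (G : simple_graph n)
    (hG : forall v : 'I_n, ~ null_vertex G v)
    (F : 'I_n -> 'rV[R[i]]_k) (hF : graph_frame G F) :
  tight_frame F -> uniform_frame F.
Proof.
case: hF => frameF gramF [A tightF]; split=> //.
exists (Num.sqrt (A - 1)) => v.
have degA := tight_graph_frame_degree gramF tightF (hG v).
have A1_ge0 : 0 <= A - 1 by rewrite -degA ler0n.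
rewrite (graph_frame_vnorm gramF) -(rmorph_nat (real_complex R)) degA.
by rewrite -{1}(sqr_sqrtr A1_ge0) rmorphXn /= sqrCK // lecR sqrtr_ge0.
Qed.
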